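(* Let $(K,\mathsf J)$ be a 2-site. The 2-functor $A_{\mathsf J}\colon K\to K_{\mathsf J}$ is locally fully faithful; that is, the functor $K(x,y)\to K_{\mathsf J}(x,y)$ is fully faithful for all objects $x$ and $y$ of $K$.
   Context: **Conventions.** $1_f\circ a$ and $a\circ 1_f$ denote whiskering. A 1-arrow $f\colon x\to y$ is *ff* if for all $g,h\colon w\to x$ and every $\widetilde a\colon f\circ g\Rightarrow f\circ h$ there is a unique $a\colon g\Rightarrow h$ with $\widetilde a=1_f\circ a$. A 1-arrow $j\colon u\to x$ is *co-ff* if for all $g,h\colon x\to y$ and every $\widetilde a\colon g\circ j\Rightarrow h\circ j$ there is a unique $a\colon g\Rightarrow h$ with $\widetilde a=a\circ 1_j$. **2-site.** A 2-site $(K,\mathsf J)$ is a 2-category $K$ with a class $\mathsf J$ of 1-arrows that contains all identities, is closed under composition, such that the strict pullback of an element of $\mathsf J$ along any 1-arrow exists and is again in $\mathsf J$, and such that every element of $\mathsf J$ is both ff and co-ff. All pullbacks are strict; specified pullbacks are given, and the pullback of an identity 1-arrow is an identity 1-arrow (so $x\times_xx=x$ with identity projections). **Hom-categories of $K_{\mathsf J}$.** Objects of $K_{\mathsf J}$ are those of $K$. The objects of $K_{\mathsf J}(x,y)$ are *$\mathsf J$-fractions* $(j,f)$: spans $x\xleftarrow{j}u\xrightarrow{f}y$ with $j\in\mathsf J$. An arrow $(j,f)\Rightarrow(k,g)$, where $x\xleftarrow{k}v\xrightarrow{g}y$, is a *map of $\mathsf J$-fractions*: a 2-arrow $f\circ\mathrm{pr}_1\Rightarrow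 g\circ\mathrm{pr}_2\colon u\times_xv\to y$ in $K$ (source and target fractions being part of the data). The identity on $(j,f)$ is $1_f\circ\ell_j$, where $\ell_j\colon\mathrm{pr}_1\Rightarrow\mathrm{pr}_2\colon u\times_xu\to u$ is the unique 2-arrow with $1_j\circ\ell_j$ the identity. The composite $t_1+t_2$ of $t_1\colon(j_1,f_1)\Rightarrow(j_2,f_2)$ and $t_2\colon(j_2,f_2)\Rightarrow(j_3,f_3)$ (apexes $u_1,u_2,u_3$) is the unique 2-arrow on $u_1\times_xu_3$ whose whiskering with $\mathrm{pr}_{13}\colon u_1\times_xu_2\times_xu_3\to u_1\times_xu_3$ (which is in $\mathsf J$) is $t_1\circ1_{\mathrm{pr}_{12}}$ followed by $t_2\circ1_{\mathrm{pr}_{23}}$. **$A_{\mathsf J}$** is the identity on objects, sends $f\colon x\to y$ to $(\mathrm{id}_x,f)$ and sends $a\colon f\Rightarrow g$ to the map of fractions $(\mathrm{id}_x,f)\Rightarrow(\mathrm{id}_x,g)$ given by $a$ on $x\times_xx=x$. *)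

(* Defs.v *)
From Stdlib Require Import ssreflect ProofIrrelevance ClassicalEpsilon.

Set Implicit Arguments.
Unset Strict Implicit.
Unset Printing Implicit Defensive.

Definition unique_choice {T : Type} {P : T -> Prop} (h : exists! t, P t) :
  {t : T | unique P t} := constructive_indefinite_description (unique P) h.

Declare Scope cat_scope.
Delimit Scope cat_scope with cat.
Local Open Scope cat_scope.

(* Composition is in diagrammatic order: [s ;; t] is [s] followed by [t]. *)

Reserved Notation "a ;; b" (at level 52, left associativity).

Record Category : Type := MkCategory {
  Obj :> Type;
  Mor : Obj -> Obj -> Type;
  idm : forall a : Obj, Mor a a;
  seqm : forall a b c : Obj, Mor a b -> Mor b c -> Mor a c
    where "s ;; t" := (seqm s t);
  seqm_idl : forall (a b : Obj) (s : Mor a b), idm a ;; s = s;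
  seqm_idr : forall (a b : Obj) (s : Mor a b), s ;; idm b = s;
  seqm_assoc : forall (a b c d : Obj) (s : Mor a b) (t : Mor b c) (r : Mor c d),
    s ;; (t ;; r) = s ;; t ;; r
}.
Arguments idm {_} a.
Notation "s ;; t" := (seqm s t) : cat_scope.

Record Functor (C D : Category) : Type := MkFunctor {
  fobj :> C -> D;
  fmap : forall a b : C, Mor a b -> Mor (fobj a) (fobj b);
  fmap_id : forall a : C, fmap (idm a) = idm (fobj a);
  fmap_seq : forall (a b c : C) (s : Mor a b) (t : Mor b c),
    fmap (s ;; t) = fmap s ;; fmap t
}.
Arguments fmap {C D} f {a b} s.

Definition faithful {C D : Category} (F : Functor C D) : Prop :=
  forall (a b : C) (s s' : Mor a b), fmap F s = fmap F s' -> s = s'.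

Definition full {C D : Category} (F : Functor C D) : Prop :=
  forall (a b : C) (t : Mor (F a) (F b)), exists s : Mor a b, fmap F s = t.

Definition fully_faithful {C D : Category} (F : Functor C D) : Prop :=
  full F /\ faithful F.

(* The identity, regarded as an arrow between propositionally equal objects. *)
Definition idtomor {C : Category} {a b : C} (e : a = b) : Mor a b :=
  match e in _ = c return Mor a c with eq_refl => idm a end.

(* Equality of arrows whose sources and targets agree only propositionally,
   as happens for 2-arrows of a strict 2-category, in which composition of
   1-arrows is associative and unital up to Leibniz equality. *)
Definition ceq {C : Category} {a b a' b' : C} (s : Mor a b) (s' : Mor a' b') : Prop :=
  exists (ea : a = a') (eb : b = b'), s ;; idtomor eb = idtomor ea ;; s'.
Notation "s ~= t" := (ceq s t) (at level 70, no associativity) : cat_scope.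

(* [s] followed by [t], when the target of [s] is propositionally the source
   of [t]. *)
Definition glue {C : Category} {a b b' c : C} (s : Mor a b) (e : b = b')
  (t : Mor b' c) : Mor a c := s ;; idtomor e ;; t.

(* Strict 2-categories.  The 2-arrows f => g are the arrows [Mor f g] of
   [hom x y], with vertical composition [;;]; the horizontal composite
   [b \h a] is, like [g \o f], in applicative order. *)

Reserved Notation "g \o f" (at level 40, left associativity).
Reserved Notation "b \h a" (at level 40, left associativity).

Record TwoCategory : Type := MkTwoCategory {
  ob :> Type;
  hom : ob -> ob -> Category;
  id1 : forall x : ob, hom x x;
  comp1 : forall x y z : ob, hom y z -> hom x y -> hom x z
    where "g \o f" := (comp1 g f);
  hcomp : forall (x y z : ob) (g g' : hom y z) (f f' : hom x y),
    Mor g g' -> Mor f f' -> Mor (g \o f) (g' \o f')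
    where "b \h a" := (hcomp b a);
  hcomp_id : forall (x y z : ob) (g : hom y z) (f : hom x y),
    idm g \h idm f = idm (g \o f);
  hcomp_seq : forall (x y z : ob) (g g' g'' : hom y z) (f f' f'' : hom x y)
      (b : Mor g g') (b' : Mor g' g'') (a : Mor f f') (a' : Mor f' f''),
    (b ;; b') \h (a ;; a') = (b \h a) ;; (b' \h a');
  comp1_idl : forall (x y : ob) (f : hom x y), id1 y \o f = f;
  comp1_idr : forall (x y : ob) (f : hom x y), f \o id1 x = f;
  comp1_assoc : forall (w x y z : ob) (h : hom y z) (g : hom x y) (f : hom w x),
    h \o (g \o f) = h \o g \o f;
  hcomp_idl : forall (x y : ob) (f f' : hom x y) (a : Mor f f'),
    idm (id1 y) \h a ~= a;
  hcomp_idr : forall (x y : ob) (f f' : hom x y) (a : Mor f f'),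
    a \h idm (id1 x) ~= a;
  hcomp_assoc : forall (w x y z : ob) (h h' : hom y z) (g g' : hom x y)
      (f f' : hom w x) (c : Mor h h') (b : Mor g g') (a : Mor f f'),
    c \h (b \h a) ~= c \h b \h a
}.
Arguments id1 {_} x.
Notation "g \o f" := (comp1 g f) : cat_scope.
Notation "b \h a" := (hcomp b a) : cat_scope.

Definition whiskL {K : TwoCategory} {x y z : K} (f : hom y z) {g h : hom x y}
  (a : Mor g h) : Mor (f \o g) (f \o h) := idm f \h a.
Definition whiskR {K : TwoCategory} {x y z : K} {g h : hom y z} (a : Mor g h)
  (f : hom x y) : Mor (g \o f) (h \o f) := a \h idm f.
Notation "f <| a" := (whiskL f a) (at level 45, right associativity) : cat_scope.
Notation "a |> f" := (whiskR a f) (at level 44, left associativity) : cat_scope.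

Definition ff {K : TwoCategory} {x y : K} (f : hom x y) : Prop :=
  forall (w : K) (g h : hom w x) (a' : Mor (f \o g) (f \o h)),
    exists! a : Mor g h, a' = f <| a.

Definition coff {K : TwoCategory} {u x : K} (j : hom u x) : Prop :=
  forall (y : K) (g h : hom x y) (a' : Mor (g \o j) (h \o j)),
    exists! a : Mor g h, a' = a |> j.

Record Span (K : TwoCategory) (z u : K) : Type := MkSpan {
  apex : K;
  leg1 : hom apex z;
  leg2 : hom apex u
}.
Arguments MkSpan {K z u apex} leg1 leg2.

(* The universal property of a strict pullback in a 2-category is that of a
   Cat-enriched limit, hence has a 1- and a 2-dimensional part. *)
Definition is_strict_pullback {K : TwoCategory} {x z u : K} (f : hom z x)
    (g : hom u x) (P : Span z u) : Prop :=
  f \o leg1 P = g \o leg2 P /\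
  (forall (w : K) (a : hom w z) (b : hom w u), f \o a = g \o b ->
     exists! c : hom w (apex P), leg1 P \o c = a /\ leg2 P \o c = b) /\
  (forall (w : K) (c d : hom w (apex P))
      (a : Mor (leg1 P \o c) (leg1 P \o d)) (b : Mor (leg2 P \o c) (leg2 P \o d)),
     f <| a ~= g <| b ->
     exists! t : Mor c d, leg1 P <| t = a /\ leg2 P <| t = b).

(* [pb f j _] is the specified pullback of [j] along [f]; its first leg is the
   pulled-back 1-arrow.  [pb_idr] and [pb_idl] say that, when either side of
   the cospan is an identity, so is the opposite leg. *)
Record TwoSite : Type := MkTwoSite {
  site :> TwoCategory;
  J : forall u x : site, hom u x -> Prop;
  J_id : forall x : site, J (id1 x);
  J_comp : forall (u v x : site) (j : hom v x) (k : hom u v),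
    J j -> J k -> J (j \o k);
  J_ff : forall (u x : site) (j : hom u x), J j -> ff j;
  J_coff : forall (u x : site) (j : hom u x), J j -> coff j;
  pb : forall (x z u : site) (f : hom z x) (j : hom u x), J j -> Span z u;
  pb_pullback : forall (x z u : site) (f : hom z x) (j : hom u x) (Jj : J j),
    is_strict_pullback f j (pb f Jj);
  pb_J : forall (x z u : site) (f : hom z x) (j : hom u x) (Jj : J j),
    J (leg1 (pb f Jj));
  pb_idr : forall (x z : site) (f : hom z x) (Jid : J (id1 x)),
    pb f Jid = MkSpan (id1 z) f;
  pb_idl : forall (x u : site) (j : hom u x) (Jj : J j),
    pb (id1 x) Jj = MkSpan j (id1 u)
}.
Arguments J {_ _ _} j.

Lemma idtomor_idm {C : Category} {a : C} (e : a = a) : idtomor e = idm a.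
Proof. by rewrite (proof_irrelevance _ e eq_refl). Qed.

Lemma ceq_refl {C : Category} {a b : C} (s : Mor a b) : s ~= s.
Proof. by exists eq_refl, eq_refl; rewrite /= seqm_idl seqm_idr. Qed.

Lemma eq_ceq {C : Category} {a b : C} (s t : Mor a b) : s = t -> s ~= t.
Proof. by move=> ->; apply: ceq_refl. Qed.

Lemma ceq_eq {C : Category} {a b : C} (s t : Mor a b) : s ~= t -> s = t.
Proof.
move=> [ea [eb]]; rewrite (idtomor_idm ea) (idtomor_idm eb).
by rewrite seqm_idl seqm_idr.
Qed.

Lemma ceq_ind_hom {C : Category} {a b : C} (s : Mor a b)
    (Q : forall (a' b' : C), Mor a' b' -> Prop) :
  Q a b s -> forall (a' b' : C) (t : Mor a' b'), s ~= t -> Q a' b' t.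
Proof.
move=> Qs a' b' t [ea [eb]]; destruct ea, eb => /=.
by rewrite seqm_idl seqm_idr => <-.
Qed.

Lemma ceq_sym {C : Category} {a b a' b' : C} (s : Mor a b) (t : Mor a' b') :
  s ~= t -> t ~= s.
Proof. by move: a' b' t; apply: ceq_ind_hom; apply: ceq_refl. Qed.

Lemma ceq_trans {C : Category} {a b a' b' a'' b'' : C} (s : Mor a b)
    (t : Mor a' b') (r : Mor a'' b'') : s ~= t -> t ~= r -> s ~= r.
Proof. by move=> st; move: a'' b'' r; apply: ceq_ind_hom. Qed.

Lemma ceq_idm {C : Category} {a b : C} : a = b -> idm a ~= idm b.
Proof. by move=> ->; apply: ceq_refl. Qed.

Lemma idtomor_ceq {C : Category} {a b : C} (e : a = b) : idtomor e ~= idm a.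
Proof. by destruct e; apply: ceq_refl. Qed.

Lemma ceq_idtomor {C : Category} {a b c d : C} (e : a = b) (s : Mor b c)
    (e' : c = d) : idtomor e ;; s ;; idtomor e' ~= s.
Proof.
destruct e, e'; rewrite /= seqm_idl seqm_idr; exact: ceq_refl.
Qed.

Lemma ceq_glue {C : Category} {a b c d a' b' c' d' : C}
    (s : Mor a b) (e : b = c) (t : Mor c d)
    (s' : Mor a' b') (e' : b' = c') (t' : Mor c' d') :
  s ~= s' -> t ~= t' -> glue s e t ~= glue s' e' t'.
Proof.
move=> ss tt; destruct e; move: a' b' s' ss e'.
apply: ceq_ind_hom => e'; destruct e'.
case: tt => e [e2]; destruct e2; rewrite (idtomor_idm e) /= seqm_idl seqm_idr.
by move=> ->; apply: ceq_refl.
Qed.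

Lemma glue_assoc {C : Category} {a b b' c c' d : C} (s : Mor a b) (e : b = b')
    (t : Mor b' c) (e' : c = c') (r : Mor c' d) :
  glue (glue s e t) e' r = glue s e (glue t e' r).
Proof. by rewrite /glue !seqm_assoc. Qed.

Lemma glue_refl {C : Category} {a b c : C} (s : Mor a b) (t : Mor b c) :
  glue s eq_refl t = s ;; t.
Proof. by rewrite /glue /= seqm_idr. Qed.

Lemma glue_idml {C : Category} {a b c d : C} (s : Mor a b) (e : b = c)
    (t : Mor c d) (k : C) : s ~= idm k -> glue s e t ~= t.
Proof.
move=> sk; have ek : k = c by case: sk => ea [eb _]; rewrite -eb.
destruct ek; apply: (ceq_trans (ceq_glue e eq_refl sk (ceq_refl t))).
by rewrite glue_refl seqm_idl; apply: ceq_refl.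
Qed.

Lemma glue_idmr {C : Category} {a b c d : C} (s : Mor a b) (e : b = c)
    (t : Mor c d) (k : C) : t ~= idm k -> glue s e t ~= s.
Proof.
move=> tk; have ek : b = k by case: tk => ea _; rewrite e.
destruct ek; apply: (ceq_trans (ceq_glue e eq_refl (ceq_refl s) tk)).
by rewrite glue_refl seqm_idr; apply: ceq_refl.
Qed.

Lemma ceq_whiskR {K : TwoCategory} {x y z : K} {g h g' h' : hom y z}
    (a : Mor g h) (a' : Mor g' h') (f f' : hom x y) :
  a ~= a' -> f = f' -> a |> f ~= a' |> f'.
Proof.
move=> aa <-; move: g' h' a' aa.
by apply: ceq_ind_hom; apply: ceq_refl.
Qed.

Lemma ceq_whiskL {K : TwoCategory} {x y z : K} {g h g' h' : hom x y}
    (f f' : hom y z) (a : Mor g h) (a' : Mor g' h') :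
  f = f' -> a ~= a' -> f <| a ~= f' <| a'.
Proof.
move=> <- aa; move: g' h' a' aa.
by apply: ceq_ind_hom; apply: ceq_refl.
Qed.

Lemma whiskR_idm {K : TwoCategory} {x y z : K} (g : hom y z) (f : hom x y) :
  idm g |> f = idm (g \o f).
Proof. exact: hcomp_id. Qed.

Lemma whiskL_idm {K : TwoCategory} {x y z : K} (g : hom y z) (f : hom x y) :
  g <| idm f = idm (g \o f).
Proof. exact: hcomp_id. Qed.

Lemma whiskR_seq {K : TwoCategory} {x y z : K} {g h k : hom y z} (a : Mor g h)
    (b : Mor h k) (f : hom x y) : (a ;; b) |> f = (a |> f) ;; (b |> f).
Proof. by rewrite /whiskR -hcomp_seq seqm_idl. Qed.

Lemma whiskR_comp {K : TwoCategory} {w x y z : K} {g h : hom y z} (a : Mor g h)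
    (f : hom x y) (k : hom w x) : a |> f |> k ~= a |> (f \o k).
Proof. by apply: ceq_sym; rewrite /whiskR -hcomp_id; apply: hcomp_assoc. Qed.

Lemma whiskR_id1 {K : TwoCategory} {y z : K} {g h : hom y z} (a : Mor g h) :
  a |> id1 y ~= a.
Proof. exact: hcomp_idr. Qed.

Lemma whiskLR {K : TwoCategory} {w x y z : K} (f : hom y z) {g h : hom x y}
    (a : Mor g h) (k : hom w x) : (f <| a) |> k ~= f <| (a |> k).
Proof. by apply: ceq_sym; apply: hcomp_assoc. Qed.

Lemma whiskR_glue {K : TwoCategory} {x y z : K} {g h h' k : hom y z}
    (a : Mor g h) (e : h = h') (b : Mor h' k) (f : hom x y)
    (e' : h \o f = h' \o f) : (glue a e b) |> f = glue (a |> f) e' (b |> f).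
Proof.
destruct e; rewrite (proof_irrelevance _ e' eq_refl) !glue_refl.
exact: whiskR_seq.
Qed.

Lemma coff_ceq {K : TwoCategory} {u x y : K} (j : hom u x) {g h : hom x y}
    (a b : Mor g h) : coff j -> a |> j ~= b |> j -> a = b.
Proof.
move=> cj /ceq_eq ab; case: (cj _ _ _ (a |> j)) => c [_ uc].
by rewrite -(uc a) // -(uc b).
Qed.

Lemma ff_idm {K : TwoCategory} {w x y : K} (f : hom x y) {g h k : hom w x}
    (a : Mor g h) : ff f -> g = k -> h = k ->
  f <| a ~= idm (f \o k) -> a ~= idm k.
Proof.
move=> ffj eg eh; destruct eg, eh => ea.
apply: eq_ceq; case: (ffj _ _ _ (f <| a)) => c [_ uc].
rewrite -(uc a) //; apply: uc; rewrite whiskL_idm.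
exact: ceq_eq.
Qed.

Lemma pb_comm {S : TwoSite} {x z u : S} (f : hom z x) {j : hom u x} (Jj : J j) :
  f \o leg1 (pb f Jj) = j \o leg2 (pb f Jj).
Proof. by case: (pb_pullback f Jj). Qed.

Definition pair_sig {S : TwoSite} {x z u : S} {f : hom z x} {j : hom u x} (Jj : J j)
    {w : S} {a : hom w z} {b : hom w u} (e : f \o a = j \o b) :
    {c : hom w (apex (pb f Jj)) | unique (fun c => leg1 (pb f Jj) \o c = a /\ leg2 (pb f Jj) \o c = b) c} :=
  unique_choice (proj1 (proj2 (pb_pullback f Jj)) w a b e).

Definition pair {S : TwoSite} {x z u : S} {f : hom z x} {j : hom u x} (Jj : J j)
    {w : S} {a : hom w z} {b : hom w u} (e : f \o a = j \o b) :
    hom w (apex (pb f Jj)) := proj1_sig (pair_sig Jj e).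

Lemma pair1 {S : TwoSite} {x z u : S} {f : hom z x} {j : hom u x} (Jj : J j)
    {w : S} {a : hom w z} {b : hom w u} (e : f \o a = j \o b) :
  leg1 (pb f Jj) \o pair Jj e = a.
Proof. by rewrite /pair; case: pair_sig => c [[]]. Qed.

Lemma pair2 {S : TwoSite} {x z u : S} {f : hom z x} {j : hom u x} (Jj : J j)
    {w : S} {a : hom w z} {b : hom w u} (e : f \o a = j \o b) :
  leg2 (pb f Jj) \o pair Jj e = b.
Proof. by rewrite /pair; case: pair_sig => c [[]]. Qed.

Lemma pair_uniq {S : TwoSite} {x z u : S} {f : hom z x} {j : hom u x} (Jj : J j)
    {w : S} {a : hom w z} {b : hom w u} (e : f \o a = j \o b)
    (c : hom w (apex (pb f Jj))) : leg1 (pb f Jj) \o c = a -> leg2 (pb f Jj) \o c = b -> c = pair Jj e.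
Proof.
rewrite /pair; case: pair_sig => d [_ ud] /= c1 c2.
by rewrite (ud c).
Qed.

Record fraction (S : TwoSite) (x y : S) : Type := MkFraction {
  fr_apex : S;
  fr_j : hom fr_apex x;
  fr_J : J fr_j;
  fr_map : hom fr_apex y
}.
Arguments MkFraction {S x y fr_apex} [fr_j] fr_J fr_map.

Definition fibre {S : TwoSite} {x y : S} (F G : fraction x y) :
  Span (fr_apex F) (fr_apex G) := pb (fr_j F) (fr_J G).

Definition fmor {S : TwoSite} {x y : S} (F G : fraction x y) : Type :=
  Mor (fr_map F \o leg1 (fibre F G)) (fr_map G \o leg2 (fibre F G)).

Lemma ell_exists {S : TwoSite} {x y : S} (F : fraction x y) :
  exists! l : Mor (leg1 (fibre F F)) (leg2 (fibre F F)),
    fr_j F <| l ~= idm (fr_j F \o leg1 (fibre F F)).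
Proof.
have e : fr_j F \o leg1 (fibre F F) = fr_j F \o leg2 (fibre F F) by apply: pb_comm.
case: (J_ff (fr_J F) (idtomor e)) => l [hl ul].
exists l; split; first by rewrite -hl; apply: idtomor_ceq.
move=> l' hl'; apply: ul; apply: ceq_eq.
by apply: (ceq_trans (idtomor_ceq e)); apply: ceq_sym.
Qed.

Definition ell {S : TwoSite} {x y : S} (F : fraction x y) :
  Mor (leg1 (fibre F F)) (leg2 (fibre F F)) :=
  proj1_sig (unique_choice (ell_exists F)).

Definition fmor_id {S : TwoSite} {x y : S} (F : fraction x y) : fmor F F :=
  fr_map F <| ell F.

(* u1 \times_x u2 \times_x u3, presented as the pullback of [fr_j F2] along
   u1 \times_x u3 -> x, so that [pr13] is manifestly in J. *)
Definition triple {S : TwoSite} {x y : S} (F1 F2 F3 : fraction x y) :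
  Span (apex (fibre F1 F3)) (fr_apex F2) :=
  pb (fr_j F1 \o leg1 (fibre F1 F3)) (fr_J F2).

Definition pr13 {S : TwoSite} {x y : S} (F1 F2 F3 : fraction x y) :
  hom (apex (triple F1 F2 F3)) (apex (fibre F1 F3)) := leg1 (triple F1 F2 F3).

Lemma pr12_comm {S : TwoSite} {x y : S} (F1 F2 F3 : fraction x y) :
  fr_j F1 \o (leg1 (fibre F1 F3) \o pr13 F1 F2 F3)
  = fr_j F2 \o leg2 (triple F1 F2 F3).
Proof. by rewrite comp1_assoc /pr13 /triple pb_comm. Qed.

Definition pr12 {S : TwoSite} {x y : S} (F1 F2 F3 : fraction x y) :
  hom (apex (triple F1 F2 F3)) (apex (fibre F1 F2)) :=
  pair (fr_J F2) (pr12_comm F1 F2 F3).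

Lemma pr23_comm {S : TwoSite} {x y : S} (F1 F2 F3 : fraction x y) :
  fr_j F2 \o leg2 (triple F1 F2 F3)
  = fr_j F3 \o (leg2 (fibre F1 F3) \o pr13 F1 F2 F3).
Proof. by rewrite -pr12_comm !comp1_assoc /fibre pb_comm. Qed.

Definition pr23 {S : TwoSite} {x y : S} (F1 F2 F3 : fraction x y) :
  hom (apex (triple F1 F2 F3)) (apex (fibre F2 F3)) :=
  pair (fr_J F3) (pr23_comm F1 F2 F3).

Lemma pr1_pr12 {S : TwoSite} {x y : S} (F1 F2 F3 : fraction x y) :
  leg1 (fibre F1 F2) \o pr12 F1 F2 F3 = leg1 (fibre F1 F3) \o pr13 F1 F2 F3.
Proof. exact: pair1. Qed.

Lemma pr2_pr12 {S : TwoSite} {x y : S} (F1 F2 F3 : fraction x y) :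
  leg2 (fibre F1 F2) \o pr12 F1 F2 F3 = leg2 (triple F1 F2 F3).
Proof. exact: pair2. Qed.

Lemma pr1_pr23 {S : TwoSite} {x y : S} (F1 F2 F3 : fraction x y) :
  leg1 (fibre F2 F3) \o pr23 F1 F2 F3 = leg2 (triple F1 F2 F3).
Proof. exact: pair1. Qed.

Lemma pr2_pr23 {S : TwoSite} {x y : S} (F1 F2 F3 : fraction x y) :
  leg2 (fibre F2 F3) \o pr23 F1 F2 F3 = leg2 (fibre F1 F3) \o pr13 F1 F2 F3.
Proof. exact: pair2. Qed.

Lemma pr_middle {S : TwoSite} {x y : S} (F1 F2 F3 : fraction x y) :
  fr_map F2 \o leg2 (fibre F1 F2) \o pr12 F1 F2 F3
  = fr_map F2 \o leg1 (fibre F2 F3) \o pr23 F1 F2 F3.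
Proof. by rewrite -!comp1_assoc pr2_pr12 pr1_pr23. Qed.

(* [t1 |> pr12] followed by [t2 |> pr23], on u1 \times_x u2 \times_x u3. *)
Definition pasting {S : TwoSite} {x y : S} {F1 F2 F3 : fraction x y}
    (t1 : fmor F1 F2) (t2 : fmor F2 F3) :
  Mor (fr_map F1 \o leg1 (fibre F1 F2) \o pr12 F1 F2 F3)
      (fr_map F3 \o leg2 (fibre F2 F3) \o pr23 F1 F2 F3) :=
  glue (t1 |> pr12 F1 F2 F3) (pr_middle F1 F2 F3) (t2 |> pr23 F1 F2 F3).

Lemma fmor_seq_exists {S : TwoSite} {x y : S} {F1 F2 F3 : fraction x y}
    (t1 : fmor F1 F2) (t2 : fmor F2 F3) :
  exists! t : fmor F1 F3, t |> pr13 F1 F2 F3 ~= pasting t1 t2.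
Proof.
have e1 : fr_map F1 \o leg1 (fibre F1 F3) \o pr13 F1 F2 F3
    = fr_map F1 \o leg1 (fibre F1 F2) \o pr12 F1 F2 F3.
  by rewrite -!comp1_assoc pr1_pr12.
have e2 : fr_map F3 \o leg2 (fibre F2 F3) \o pr23 F1 F2 F3
    = fr_map F3 \o leg2 (fibre F1 F3) \o pr13 F1 F2 F3.
  by rewrite -!comp1_assoc pr2_pr23.
pose p := glue (idm _) e1 (glue (pasting t1 t2) e2 (idm _)).
have pE : p ~= pasting t1 t2.
  apply: (ceq_trans (glue_idml _ _ (ceq_refl _))).
  exact: (glue_idmr _ _ (ceq_refl _)).
have cj : coff (pr13 F1 F2 F3) by apply: J_coff; apply: pb_J.
case: (cj _ _ _ p) => t [ht ut].
exists t; split; first by rewrite -ht.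
move=> t' ht'; apply: ut; apply: ceq_eq.
by apply: (ceq_trans pE); apply: ceq_sym.
Qed.

Definition fmor_seq {S : TwoSite} {x y : S} {F1 F2 F3 : fraction x y}
    (t1 : fmor F1 F2) (t2 : fmor F2 F3) : fmor F1 F3 :=
  proj1_sig (unique_choice (fmor_seq_exists t1 t2)).

Lemma ellE {S : TwoSite} {x y : S} (F : fraction x y) :
  fr_j F <| ell F ~= idm (fr_j F \o leg1 (fibre F F)).
Proof. by rewrite /ell; case: unique_choice => l []. Qed.

Lemma fmor_seqE {S : TwoSite} {x y : S} {F1 F2 F3 : fraction x y}
    (t1 : fmor F1 F2) (t2 : fmor F2 F3) :
  fmor_seq t1 t2 |> pr13 F1 F2 F3 ~= pasting t1 t2.
Proof. by rewrite /fmor_seq; case: unique_choice => l []. Qed.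

Lemma fmor_seq_uniq {S : TwoSite} {x y : S} {F1 F2 F3 : fraction x y}
    (t1 : fmor F1 F2) (t2 : fmor F2 F3) (t : fmor F1 F3) :
  t |> pr13 F1 F2 F3 ~= pasting t1 t2 -> t = fmor_seq t1 t2.
Proof.
by rewrite /fmor_seq; case: unique_choice => l [_ ul] /= /ul.
Qed.

(* A map of fractions restricted along a pair of generalised elements a, b of
   the two apexes lying over the same generalised element of x. *)
Definition at_ {S : TwoSite} {x y : S} {F G : fraction x y} (t : fmor F G)
    {w : S} {a : hom w (fr_apex F)} {b : hom w (fr_apex G)}
    (e : fr_j F \o a = fr_j G \o b) :
  Mor (fr_map F \o leg1 (fibre F G) \o pair (fr_J G) e)
      (fr_map G \o leg2 (fibre F G) \o pair (fr_J G) e) :=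
  t |> pair (fr_J G) e.

Lemma at_whiskR {S : TwoSite} {x y : S} {F G : fraction x y} (t : fmor F G)
    {w : S} (c : hom w (apex (fibre F G)))
    {a : hom w (fr_apex F)} {b : hom w (fr_apex G)}
    (e : fr_j F \o a = fr_j G \o b) :
  leg1 (fibre F G) \o c = a -> leg2 (fibre F G) \o c = b -> t |> c ~= at_ t e.
Proof.
move=> c1 c2; apply: (ceq_whiskR (ceq_refl t)).
exact: pair_uniq.
Qed.

Lemma at_fmor_id {S : TwoSite} {x y : S} {F : fraction x y} {w : S}
    {a : hom w (fr_apex F)} (e : fr_j F \o a = fr_j F \o a) :
  at_ (fmor_id F) e ~= idm (fr_map F \o a).
Proof.
apply: (ceq_trans (whiskLR _ _ _)).
rewrite -whiskL_idm; apply: ceq_whiskL => //.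
apply: (ff_idm (J_ff (fr_J F))); [exact: pair1 | exact: pair2 |].
apply: (ceq_trans (ceq_sym (whiskLR _ _ _))).
apply: (ceq_trans (ceq_whiskR (ellE F) eq_refl)).
rewrite whiskR_idm; apply: ceq_idm.
by rewrite -comp1_assoc pair1.
Qed.

Lemma at_middle {S : TwoSite} {x y : S} {F1 F2 F3 : fraction x y} {w : S}
    {a1 : hom w (fr_apex F1)} {a2 : hom w (fr_apex F2)} {a3 : hom w (fr_apex F3)}
    (e12 : fr_j F1 \o a1 = fr_j F2 \o a2) (e23 : fr_j F2 \o a2 = fr_j F3 \o a3) :
  fr_map F2 \o leg2 (fibre F1 F2) \o pair (fr_J F2) e12
  = fr_map F2 \o leg1 (fibre F2 F3) \o pair (fr_J F3) e23.
Proof. by rewrite -!comp1_assoc pair1 pair2. Qed.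

Lemma at_fmor_seq {S : TwoSite} {x y : S} {F1 F2 F3 : fraction x y}
    (t1 : fmor F1 F2) (t2 : fmor F2 F3) {w : S}
    {a1 : hom w (fr_apex F1)} {a2 : hom w (fr_apex F2)} {a3 : hom w (fr_apex F3)}
    (e12 : fr_j F1 \o a1 = fr_j F2 \o a2) (e23 : fr_j F2 \o a2 = fr_j F3 \o a3)
    (e13 : fr_j F1 \o a1 = fr_j F3 \o a3) :
  at_ (fmor_seq t1 t2) e13 ~= glue (at_ t1 e12) (at_middle e12 e23) (at_ t2 e23).
Proof.
have eh : (fr_j F1 \o leg1 (fibre F1 F3)) \o pair (fr_J F3) e13 = fr_j F2 \o a2.
  by rewrite -comp1_assoc pair1.
pose h : hom w (apex (triple F1 F2 F3)) := pair (fr_J F2) eh.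
have h13 : pr13 F1 F2 F3 \o h = pair (fr_J F3) e13 by apply: pair1.
have h2 : leg2 (triple F1 F2 F3) \o h = a2 by apply: pair2.
have h1 : leg1 (fibre F1 F3) \o pr13 F1 F2 F3 \o h = a1.
  by rewrite -comp1_assoc h13; apply: pair1.
have h3 : leg2 (fibre F1 F3) \o pr13 F1 F2 F3 \o h = a3.
  by rewrite -comp1_assoc h13; apply: pair2.
rewrite /at_ -h13.
apply: (ceq_trans (ceq_sym (whiskR_comp _ _ _))).
apply: (ceq_trans (ceq_whiskR (fmor_seqE _ _) eq_refl)).
have em : fr_map F2 \o leg2 (fibre F1 F2) \o pr12 F1 F2 F3 \o h
    = fr_map F2 \o leg1 (fibre F2 F3) \o pr23 F1 F2 F3 \o h by rewrite pr_middle.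
rewrite /pasting (whiskR_glue _ _ _ em).
apply: ceq_glue; apply: (ceq_trans (whiskR_comp _ _ _)); apply: at_whiskR.
- by rewrite comp1_assoc pr1_pr12.
- by rewrite comp1_assoc pr2_pr12.
- by rewrite comp1_assoc pr1_pr23.
- by rewrite comp1_assoc pr2_pr23.
Qed.

Lemma at_self {S : TwoSite} {x y : S} {F G : fraction x y} (t : fmor F G)
    (e : fr_j F \o leg1 (fibre F G) = fr_j G \o leg2 (fibre F G)) :
  t ~= at_ t e.
Proof.
apply: (ceq_trans (ceq_sym (whiskR_id1 t))).
by apply: at_whiskR; apply: comp1_idr.
Qed.

Lemma fmor_idl {S : TwoSite} {x y : S} (F G : fraction x y) (t : fmor F G) :
  fmor_seq (fmor_id F) t = t.
Proof.
have e : fr_j F \o leg1 (fibre F G) = fr_j G \o leg2 (fibre F G) by apply: pb_comm.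
apply: ceq_eq; apply: (ceq_trans (at_self _ e)).
apply: (ceq_trans (at_fmor_seq _ _ eq_refl e e)).
apply: (ceq_trans (glue_idml _ _ (at_fmor_id _))).
by apply: ceq_sym; apply: at_self.
Qed.

Lemma fmor_idr {S : TwoSite} {x y : S} (F G : fraction x y) (t : fmor F G) :
  fmor_seq t (fmor_id G) = t.
Proof.
have e : fr_j F \o leg1 (fibre F G) = fr_j G \o leg2 (fibre F G) by apply: pb_comm.
apply: ceq_eq; apply: (ceq_trans (at_self _ e)).
apply: (ceq_trans (at_fmor_seq _ _ e eq_refl e)).
apply: (ceq_trans (glue_idmr _ _ (at_fmor_id _))).
by apply: ceq_sym; apply: at_self.
Qed.

Lemma fmor_assoc {S : TwoSite} {x y : S} (F1 F2 F3 F4 : fraction x y)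
    (t1 : fmor F1 F2) (t2 : fmor F2 F3) (t3 : fmor F3 F4) :
  fmor_seq t1 (fmor_seq t2 t3) = fmor_seq (fmor_seq t1 t2) t3.
Proof.
pose T := triple F1 F2 F4.
pose Q := pb (fr_j F2 \o leg2 T) (fr_J F3).
pose p := pr13 F1 F2 F4 \o leg1 Q.
have cp : coff p by apply: J_coff; apply: J_comp; apply: pb_J.
pose a1 := leg1 (fibre F1 F4) \o p.
pose a2 := leg2 T \o leg1 Q.
pose a3 := leg2 Q.
pose a4 := leg2 (fibre F1 F4) \o p.
have e14 : fr_j F1 \o a1 = fr_j F4 \o a4.
  by rewrite /a1 /a4 !comp1_assoc /fibre pb_comm.
have e12 : fr_j F1 \o a1 = fr_j F2 \o a2.
  by rewrite /a1 /a2 /p comp1_assoc comp1_assoc (comp1_assoc (fr_j F2)) pb_comm.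
have e23 : fr_j F2 \o a2 = fr_j F3 \o a3.
  by rewrite /a2 /a3 comp1_assoc pb_comm.
have e34 : fr_j F3 \o a3 = fr_j F4 \o a4 by rewrite -e23 -e12.
have e13 : fr_j F1 \o a1 = fr_j F3 \o a3 by rewrite e12.
have e24 : fr_j F2 \o a2 = fr_j F4 \o a4 by rewrite -e12.
apply: (coff_ceq cp).
apply: (@ceq_trans _ _ _ _ _ _ _ _ (at_ (fmor_seq t1 (fmor_seq t2 t3)) e14)).
  exact: at_whiskR.
apply: (@ceq_trans _ _ _ _ _ _ _ _ (at_ (fmor_seq (fmor_seq t1 t2) t3) e14));
  last by apply: ceq_sym; apply: at_whiskR.
apply: (ceq_trans (at_fmor_seq _ _ e12 e24 e14)).
apply: ceq_sym; apply: (ceq_trans (at_fmor_seq _ _ e13 e34 e14)).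
have m : fr_map F3 \o leg2 (fibre F2 F3) \o pair (fr_J F3) e23
    = fr_map F3 \o leg1 (fibre F3 F4) \o pair (fr_J F4) e34 by apply: at_middle.
apply: (@ceq_trans _ _ _ _ _ _ _ _
  (glue (glue (at_ t1 e12) (at_middle e12 e23) (at_ t2 e23)) m (at_ t3 e34))).
  by apply: ceq_glue; [apply: at_fmor_seq | apply: ceq_refl].
rewrite glue_assoc.
apply: ceq_glue; first exact: ceq_refl.
by apply: ceq_sym; apply: (ceq_trans (at_fmor_seq _ _ e23 e34 e24));
  apply: ceq_glue; apply: ceq_refl.
Qed.

Definition KJ (S : TwoSite) (x y : S) : Category :=
  {| Obj := fraction x y;
     Mor := @fmor S x y;
     idm := @fmor_id S x y;
     seqm := @fmor_seq S x y;
     seqm_idl := @fmor_idl S x y;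
     seqm_idr := @fmor_idr S x y;
     seqm_assoc := @fmor_assoc S x y |}.

Definition AJ_obj {S : TwoSite} {x y : S} (f : hom x y) : fraction x y :=
  MkFraction (J_id x) f.

(* [AJ_obj f] and [AJ_obj g] have fibre product x \times_x x, which [pb_idr]
   identifies with x, with identity projections; under this identification
   the map is [a] itself. *)
Definition AJ_map {S : TwoSite} {x y : S} {f g : hom x y} (a : Mor f g) :
    fmor (AJ_obj f) (AJ_obj g) :=
  @eq_rect_r _ (MkSpan (id1 x) (id1 x))
    (fun P : Span x x => Mor (f \o leg1 P) (g \o leg2 P))
    (idtomor (comp1_idr f) ;; a ;; idtomor (eq_sym (comp1_idr g)))
    _ (pb_idr (id1 x) (J_id x)).

Lemma AJ_mapE {S : TwoSite} {x y : S} {f g : hom x y} (a : Mor f g) :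
  AJ_map a ~= a |> leg1 (fibre (AJ_obj f) (AJ_obj g)).
Proof.
rewrite /AJ_map /fibre /=.
move: (pb _ _) (pb_idr _ _) => P e.
rewrite /eq_rect_r; move: (eq_sym e) => {}e; destruct e => /=.
apply: (ceq_trans (ceq_idtomor _ _ _)).
by apply: ceq_sym; apply: whiskR_id1.
Qed.

Lemma AJ_map_id {S : TwoSite} {x y : S} (f : hom x y) :
  AJ_map (idm f) = fmor_id (AJ_obj f).
Proof.
pose F := AJ_obj f.
have e12 : leg1 (fibre F F) = leg2 (fibre F F).
  by rewrite /fibre pb_idr.
apply: ceq_eq; apply: (ceq_trans (AJ_mapE _)).
rewrite whiskR_idm /fmor_id; apply: ceq_sym.
rewrite -whiskL_idm; apply: ceq_whiskL => //.
by apply: (ff_idm (J_ff (fr_J F)) eq_refl (eq_sym e12)); apply: ellE.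
Qed.

Lemma AJ_map_seq {S : TwoSite} {x y : S} (f g h : hom x y) (a : Mor f g)
    (b : Mor g h) : AJ_map (a ;; b) = fmor_seq (AJ_map a) (AJ_map b).
Proof.
apply: fmor_seq_uniq.
pose F := AJ_obj f; pose G := AJ_obj g; pose H := AJ_obj h.
pose r := leg2 (triple F G H).
have er : leg1 (fibre F H) \o pr13 F G H = r.
  by move: (pr12_comm F G H); rewrite /= !comp1_idl.
apply: (@ceq_trans _ _ _ _ _ _ _ _ ((a ;; b) |> r)).
  apply: (ceq_trans (ceq_whiskR (AJ_mapE _) eq_refl)).
  apply: (ceq_trans (whiskR_comp _ _ _)).
  by apply: ceq_whiskR; [apply: ceq_refl | apply: er].
rewrite whiskR_seq -glue_refl; apply: ceq_sym; apply: ceq_glue.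
- apply: (ceq_trans (ceq_whiskR (AJ_mapE _) eq_refl)).
  apply: (ceq_trans (whiskR_comp _ _ _)).
  by apply: ceq_whiskR; [apply: ceq_refl | rewrite pr1_pr12].
- apply: (ceq_trans (ceq_whiskR (AJ_mapE _) eq_refl)).
  apply: (ceq_trans (whiskR_comp _ _ _)).
  by apply: ceq_whiskR; [apply: ceq_refl | rewrite pr1_pr23].
Qed.

Definition AJ (S : TwoSite) (x y : S) : Functor (hom x y) (KJ x y) :=
  @MkFunctor (hom x y) (KJ x y) AJ_obj (fun f g a => AJ_map a)
    (@AJ_map_id S x y) (@AJ_map_seq S x y).

(* Main.v *)
Require Import Defs.
From Stdlib Require Import ssreflect.

Local Open Scope cat_scope.

(** The map of fractions attached to [a : f => g] is, up to the identification
    of [x \times_x x] with [x], the whiskering of [a] with the first projection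
    [p] of [x \times_x x] (lemma [AJ_mapE]).  Since [p] is pulled back from an
    identity it lies in J, hence it is co-ff, so whiskering with [p] is a
    bijection from the 2-arrows [f => g] to the 2-arrows [f \o p => g \o p].
    The two projections of [x \times_x x] coincide, so the latter are exactly
    the maps of fractions from [AJ_obj f] to [AJ_obj g]. *)

Lemma coff_leg1_AJ {S : TwoSite} {x y : S} (f g : hom x y) :
  coff (leg1 (fibre (AJ_obj f) (AJ_obj g))).
Proof. by apply: J_coff; apply: pb_J. Qed.

Lemma legs_AJ {S : TwoSite} {x y : S} (f g : hom x y) :
  leg2 (fibre (AJ_obj f) (AJ_obj g)) = leg1 (fibre (AJ_obj f) (AJ_obj g)).
Proof. by rewrite /fibre pb_idr. Qed.

Lemma AJ_map_inj {S : TwoSite} {x y : S} {f g : hom x y} (a b : Mor f g) :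
  AJ_map a = AJ_map b -> a = b.
Proof.
move=> ab; apply: (coff_ceq (coff_leg1_AJ f g)).
apply: (ceq_trans (ceq_sym (AJ_mapE a))).
by rewrite ab; apply: AJ_mapE.
Qed.

Lemma AJ_map_surj {S : TwoSite} {x y : S} {f g : hom x y}
    (t : fmor (AJ_obj f) (AJ_obj g)) : exists a : Mor f g, AJ_map a = t.
Proof.
have e : g \o leg2 (fibre (AJ_obj f) (AJ_obj g))
    = g \o leg1 (fibre (AJ_obj f) (AJ_obj g)) by rewrite legs_AJ.
(* Co-ffness speaks of 2-arrows whose two ends are precomposed with the same
   1-arrow, so the target of [t] is first moved from one leg to the other. *)
case: (coff_leg1_AJ f g _ f g (t ;; idtomor e)) => a [ta _].
exists a; apply: ceq_eq; apply: (ceq_trans (AJ_mapE a)); rewrite -ta.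
by rewrite -(seqm_idl (t ;; _)) seqm_assoc; apply: (ceq_idtomor eq_refl).
Qed.

Theorem lemma3p21 (S : TwoSite) (x y : S) : fully_faithful (AJ x y).
Proof.
split.
- by move=> f g t; apply: AJ_map_surj.
- by move=> f g a b; apply: AJ_map_inj.
Qed.
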